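(* Let $(X,x)$ be a pointed diffeological space and let $\mathcal{G}$ be a local generating category of $X$ at $x$. Then there is a natural epimorphism of vector spaces from $\operatorname{colim}(\mathcal{G} \hookrightarrow \mathcal{G}(X,x) \to \mathrm{Vect})$ to $T_x(X)$. Moreover, if $\mathcal{G}$ is a final subcategory of $\mathcal{G}(X,x)$, then this map is an isomorphism.
   Context: A diffeological space is a set $X$ together with, for every open subset $U$ of every $\mathbb{R}^n$, a set of functions $U\to X$ called plots, such that constant maps are plots, the composite of a plot with a smooth map $V\to U$ between open subsets of Euclidean spaces is a plot, and a function which is locally a plot (on an open cover) is a plot. Smooth maps are maps sending plots to plots. For a pointed diffeological space $(X,x)$, let $\mathcal{G}(X,x)$ be the category whose objects are the plots $p:U\to X$ with $U$ a connected open neighbourhood of $0$ in some $\mathbb{R}^n$ and $p(0)=x$, and whose morphisms from $p:U\to X$ to $q:V\to X$ are germs at $0$ of smooth maps $f:W\to V$ with $W$ an open neighbourhood of $0$ in $U$, $f(0)=0$ and $p|_W=q\circ f$. The functor $\mathcal{G}(X,x)\to \mathrm{Vect}$ (real vector spaces) sends $p:U\to X$ to $T_0(U)$ and $[f]$ to the differential $f_*:T_0(U)\to T_0(V)$; the internal tangent space $T_x(X)$ is the colimit of this functor. A local generating set of $X$ at $x$ is a subset $G$ of the objects of $\mathcal{G}(X,x)$ such that for every object $p$ there is some $q\in G$ and a morphism $p\to q$ in $\mathcal{G}(X,x)$; a local generating category of $X$ at $x$ is a subcategory of $\mathcal{G}(X,x)$ whose set of objects is a local generating set. A subcategory $\mathcal{G}$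 is final if for every object $p$ of $\mathcal{G}(X,x)$ the comma category $p/\mathcal{G}$ is non-empty and connected. *)

(* Defs.v *)
From mathcomp Require Import all_boot all_algebra all_classical all_reals all_analysis.
From Stdlib Require Import Relations.
Import GRing.Theory Num.Theory.
Unset Printing Implicit Defensive.
Local Open Scope ring_scope.
Local Open Scope classical_set_scope.

Section Diffeology.
Variable R : realType.

Definition E (k : nat) : normedModType R := 'rV[R]_k.

Fixpoint iter_deriv (n m : nat) (vs : seq (E n)) (f : E n -> E m) : E n -> E m :=
  if vs is v :: vs' then fun y => 'D_v (iter_deriv n m vs' f) y else f.

Definition smooth_on (n m : nat) (U : set (E n)) (f : E n -> E m) : Prop :=
  forall vs : seq (E n),
    (forall y, U y -> {for y, continuous (iter_deriv n m vs f)}) /\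
    (forall y v, U y -> derivable (iter_deriv n m vs f) y v).

(* A diffeology on a type X.  A plot with domain U is encoded as a total
   function E n -> X of which only the values on U matter (plot_ext). *)
Record diffeology (X : Type) := Diffeology {
  plot : forall n : nat, set (E n) -> (E n -> X) -> Prop;
  plot_open : forall n U p, plot n U p -> open U;
  plot_ext : forall n (U : set (E n)) (p q : E n -> X),
      (forall u, U u -> p u = q u) -> plot n U p -> plot n U q;
  plot_const : forall n (U : set (E n)) (c : X), open U -> plot n U (fun _ => c);
  plot_comp : forall n m (U : set (E n)) (V : set (E m)) p (f : E m -> E n),
      plot n U p -> open V -> smooth_on m n V f -> f @` V `<=` U -> plot m V (p \o f);
  plot_local : forall n (U : set (E n)) p, open U ->
      (forall u, U u -> exists W : set (E n),
          [/\ open W, W u, W `<=` U & plot n W p]) -> plot n U p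
}.

Variables (X : Type) (D : diffeology X) (x : X).

Record gobj := GObj { gdim : nat; gdom : set (E gdim); gplot : E gdim -> X }.

Definition is_gobj (p : gobj) : Prop :=
  [/\ open (gdom p), connected (gdom p), gdom p 0,
      plot X D (gdim p) (gdom p) (gplot p) & gplot p 0 = x].

Definition is_grep (p q : gobj) (W : set (E (gdim p))) (f : E (gdim p) -> E (gdim q)) :=
  [/\ open W, W 0, W `<=` gdom p & smooth_on (gdim p) (gdim q) W f] /\
  [/\ f @` W `<=` gdom q, f 0 = 0 & forall w, W w -> gplot p w = gplot q (f w)].

(* f represents (the germ at 0 of) a morphism p -> q in G(X,x) *)
Definition ghom (p q : gobj) (f : E (gdim p) -> E (gdim q)) : Prop :=
  is_gobj p /\ is_gobj q /\ exists W, is_grep p q W f.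

Definition germ_eq (n m : nat) (f g : E n -> E m) : Prop :=
  \forall w \near (0 : E n), f w = g w.

Definition homs := forall p q : gobj, (E (gdim p) -> E (gdim q)) -> Prop.

(* (Ob, Hom) is a subcategory of G(X,x); Hom is a set of germs *)
Definition subcategory (Ob : gobj -> Prop) (Hom : homs) : Prop :=
  [/\ (forall p, Ob p -> is_gobj p),
      (forall p q f, Hom p q f -> [/\ Ob p, Ob q & ghom p q f]),
      (forall p q f g, Hom p q f -> ghom p q g -> germ_eq (gdim p) (gdim q) f g -> Hom p q g),
      (forall p, Ob p -> Hom p p id) &
      (forall p q r f g, Hom p q f -> Hom q r g -> Hom p r (g \o f))].

Definition local_generating_set (Ob : gobj -> Prop) : Prop :=
  forall p, is_gobj p -> exists q f, Ob q /\ ghom p q f.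

Definition local_generating_category (Ob : gobj -> Prop) (Hom : homs) : Prop :=
  subcategory Ob Hom /\ local_generating_set Ob.

Definition comma_obj (p : gobj) := {q : gobj & E (gdim p) -> E (gdim q)}.

Definition comma_valid (Ob : gobj -> Prop) (p : gobj) (a : comma_obj p) : Prop :=
  Ob (projT1 a) /\ ghom p (projT1 a) (projT2 a).

Definition comma_step (Ob : gobj -> Prop) (Hom : homs) (p : gobj)
    (a b : comma_obj p) : Prop :=
  [/\ comma_valid Ob p a, comma_valid Ob p b &
      exists h, Hom (projT1 a) (projT1 b) h /\ germ_eq (gdim p) (gdim (projT1 b)) (h \o projT2 a) (projT2 b)].

Definition final_subcategory (Ob : gobj -> Prop) (Hom : homs) : Prop :=
  forall p, is_gobj p ->
    (exists a : comma_obj p, comma_valid Ob p a) /\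
    (forall a b : comma_obj p, comma_valid Ob p a -> comma_valid Ob p b ->
       clos_refl_sym_trans _ (comma_step Ob Hom p) a b).

Definition is_lin (L1 L2 : lmodType R) (phi : L1 -> L2) : Prop :=
  forall (a : R) (u v : L1), phi (a *: u + v) = a *: phi u + phi v.

(* cocones and colimits of  (Ob, Hom) -> G(X,x) -> Vect,  p |-> T_0(U) = R^n,
   [f] |-> f_* = d f(0). *)
Definition cocone (Ob : gobj -> Prop) (Hom : homs) (L : lmodType R)
    (iota : forall p : gobj, E (gdim p) -> L) : Prop :=
  (forall p, Ob p -> is_lin _ _ (iota p)) /\
  (forall p q f, Hom p q f -> forall v, iota q ('d f 0 v) = iota p v).

Definition is_colimit (Ob : gobj -> Prop) (Hom : homs) (L : lmodType R)
    (iota : forall p : gobj, E (gdim p) -> L) : Prop :=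
  cocone Ob Hom L iota /\
  forall (L' : lmodType R) (iota' : forall p : gobj, E (gdim p) -> L'),
    cocone Ob Hom L' iota' ->
    exists phi : L -> L', [/\ is_lin _ _ phi,
      (forall p, Ob p -> forall v, phi (iota p v) = iota' p v) &
      (forall psi : L -> L', is_lin _ _ psi ->
         (forall p, Ob p -> forall v, psi (iota p v) = iota' p v) ->
         forall y, psi y = phi y)].

End Diffeology.

(* Main.v *)
(* The comparison map is the map of colimits induced by the inclusion of the
   generating category.  It is onto because every object p of G(X,x) has a
   morphism p -> q into the generating set, so every leg of T_x(X) factors
   through a leg coming from colim G, and a subspace of a colimit containing
   the image of every leg is everything.  When G is final, sending an object p
   to the leg of colim G at any object p -> q of p/G, precomposed with the
   differential, is well defined because p/G is connected; this is a cocone on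
   G(X,x), and the induced map T_x(X) -> colim G is a left inverse.
   The analytic input is that smooth maps (all iterated directional derivatives
   exist and are continuous) are differentiable and closed under composition;
   both follow from the C^k calculus of real-valued functions, through the
   classical fact that continuous partial derivatives give differentiability. *)

From HB Require Import structures.
Require Import Defs.
From mathcomp Require Import all_boot all_algebra all_classical all_reals all_analysis.
Import GRing.Theory Num.Theory order.Order.TTheory.
Import numFieldNormedType.Exports.
Local Open Scope ring_scope.
Local Open Scope classical_set_scope.

Lemma near_in_open {T : topologicalType} {U : set T} {y} :
  open U -> U y -> \forall z \near y, U z.
Proof. by move=> oU Uy; apply: open_nbhs_nbhs. Qed.

Lemma near_eq_continuous {T U : topologicalType} {h g : T -> U} {y} :
  (\forall z \near y, h z = g z) -> {for y, continuous h} -> {for y, continuous g}.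
Proof.
move=> Hn hc; rewrite /prop_for /continuous_at -(nbhs_singleton Hn).
exact: (cvg_trans (@near_eq_cvg _ _ (nbhs y) (nbhs_filter y) h g Hn) hc).
Qed.

Section PartialDerivatives.
Context {R : realType}.

Lemma differentiable_of_littleo (V W : normedModType R) (f : V -> W)
    (df : {linear V -> W}) x :
  continuous df -> f \o shift x = cst (f x) + df +o_ 0 id -> differentiable f x.
Proof.
move=> dfc dxf.
have hdf h : (f \o shift x = cst (f x) + h +o_ 0 id) ->
    h = f \o shift x - cst (f x) +o_ 0 id.
  move=> hdf; apply: eqaddoE.
  rewrite hdf addrAC -!addrA addrC !addrA subrK.
  rewrite -[LHS]addr0 -addrA; congr (_ + _).
  by apply/eqP; rewrite eq_sym addrC addr_eq0 oppo.
apply/diffP => /=.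
apply: (@getPex _ (fun (df : {linear V -> W}) => continuous df /\
  forall y, f y = f (lim (nbhs x)) + df (y - lim (nbhs x))
                  +o_(y \near x) (y - lim (nbhs x)))).
exists df; split=> //; apply: eqaddoEx => z.
rewrite (hdf _ dxf) !addrA lim_id // /(_ \o _) /= subrK [f _ + _]addrC addrK.
rewrite -addrA -[LHS]addr0; congr (_ + _).
apply/eqP; rewrite eq_sym addrC addr_eq0 oppox; apply/eqP.
rewrite [in LHS]littleo_center0 (comp_centerK x id).
by rewrite -[- _ in RHS](comp_centerK x).
Qed.

Definition unitv {n} (i : 'I_n) : E R n := delta_mx 0 i.

Lemma mx_norm_entry n (M : E R n) i j : `|M i j| <= `|M|.
Proof.
rewrite [X in _ <= X]/Num.Def.normr /= mx_normrE.
exact: (le_bigmax _ _ (i, j)).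
Qed.

Lemma mx_norm_le n (M : E R n) b :
  0 <= b -> (forall i j, `|M i j| <= b) -> `|M| <= b.
Proof.
move=> b0 H; rewrite [X in X <= _]/Num.Def.normr /= mx_normrE.
by apply: bigmax_le => // -[i j] _; apply: H.
Qed.

Definition coord_form {n} (c : 'I_n -> R) (w : E R n) : R := \sum_i w 0 i * c i.

Lemma coord_form_linear n (c : 'I_n -> R) : linear (coord_form c).
Proof.
move=> a u v; rewrite /coord_form scaler_sumr -big_split /=.
by apply: eq_bigr => i _; rewrite !mxE mulrDl -mulrA.
Qed.

HB.instance Definition _ n (c : 'I_n -> R) :=
  GRing.isLinear.Build R _ _ _ (@coord_form n c) (@coord_form_linear n c).

Lemma coord_form_continuous n (c : 'I_n -> R) : continuous (coord_form c).
Proof.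
move=> w; apply/(@cvgrPdist_le _ _ _ (nbhs w) (nbhs_filter _)) => e e0.
pose M := 1 + \sum_i `|c i|.
have M0 : 0 < M by apply: (lt_le_trans ltr01); rewrite lerDl sumr_ge0.
apply/nbhs_ballP; exists (e / M); first exact: divr_gt0.
move=> z; rewrite -ball_normE /ball_ /= => wz.
rewrite -linearB /= /coord_form.
apply: (le_trans (ler_norm_sum _ _ _)).
apply: (@le_trans _ _ (\sum_i `|w - z| * `|c i|)).
  by apply: ler_sum => i _; rewrite normrM ler_wpM2r // mx_norm_entry.
rewrite -mulr_sumr; apply: (@le_trans _ _ (`|w - z| * M)).
  by rewrite ler_wpM2l // lerDr.
by rewrite -ler_pdivlMr // ltW.
Qed.

Lemma is_derive_line (V : normedModType R) (h : V -> R) (a v : V) (t : R) :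
  derivable h (a + t *: v) v ->
  is_derive t 1 (fun s : R => h (a + s *: v)) ('D_v h (a + t *: v)).
Proof.
have E : (fun r : R => r^-1 *: (((fun s : R => h (a + s *: v)) \o shift t) (r *: 1)
          - h (a + t *: v))) =
         (fun r : R => r^-1 *: ((h \o shift (a + t *: v)) (r *: v) - h (a + t *: v))).
  apply/funext => r /=; congr (_ *: (h _ - _)).
  by rewrite /shift /= [r%:A]mulr1 scalerDl addrCA addrA.
by move=> hd; apply: DeriveDef; [rewrite /derivable E | rewrite /derive E].
Qed.

Lemma norm_le_of_itv (t lo hi c : R) :
  c \in `[lo, hi]%R -> `|lo| <= `|t| -> `|hi| <= `|t| -> `|c| <= `|t|.
Proof.
rewrite in_itv /= => /andP[l1 l2] hl hh.
have [c0|c0] := leP 0 c.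
  by rewrite ger0_norm //; apply: le_trans hh; apply: le_trans l2 (ler_norm _).
rewrite ltr0_norm //; apply: le_trans hl; rewrite -normrN.
by apply: le_trans (ler_norm _); rewrite lerN2.
Qed.

Lemma mean_value_line (V : normedModType R) (h : V -> R) (a v : V) (t : R) :
  (forall s, `|s| <= `|t| -> derivable h (a + s *: v) v) ->
  exists2 c, `|c| <= `|t| & h (a + t *: v) - h a = 'D_v h (a + c *: v) * t.
Proof.
move=> hd; pose f s := h (a + s *: v).
have fd (s : R) : `|s| <= `|t| -> is_derive s (1 : R) f ('D_v h (a + s *: v)).
  by move=> /hd /is_derive_line.
have mvt lo hi : lo < hi -> `|lo| <= `|t| -> `|hi| <= `|t| ->
    exists2 c, `|c| <= `|t| & f hi - f lo = 'D_v h (a + c *: v) * (hi - lo).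
  move=> lohi hl hh; have inI c := @norm_le_of_itv t lo hi c.
  have fc : {within `[lo, hi], continuous f}.
    by apply: derivable_within_continuous => c cin; case: (fd c (inI c cin hl hh)).
  have [c /subset_itv_oo_cc cin ->] := MVT lohi
    (fun c cin => fd c (inI c (subset_itv_oo_cc cin) hl hh)) fc.
  by exists c => //; apply: inI.
have n0 : `|0 : R| <= `|t| by rewrite normr0.
have [t0|t0|->] := ltgtP t 0.
- have [c ct E] := mvt t 0 t0 (le_refl _) n0.
  exists c => //; move: E; rewrite /f scale0r addr0 sub0r => E.
  by rewrite -opprB E mulrN opprK.
- have [c ct E] := mvt 0 t t0 n0 (le_refl _).
  by exists c => //; move: E; rewrite /f scale0r addr0 subr0.
- by exists 0; rewrite ?normr0 // !scale0r addr0 subrr mulr0.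
Qed.

Lemma mean_value_line_le (V : normedModType R) (h : V -> R) (a v : V) (t d eps : R) :
  (forall s, `|s| <= `|t| ->
     derivable h (a + s *: v) v /\ `|'D_v h (a + s *: v) - d| <= eps) ->
  `|h (a + t *: v) - h a - t * d| <= `|t| * eps.
Proof.
move=> H; have [c ct ->] := @mean_value_line _ h a v t (fun s st => (H s st).1).
by rewrite mulrC -mulrBr normrM ler_wpM2l // (H c ct).2.
Qed.

Definition row_prefix {n} (w : E R n) (k : nat) : E R n :=
  \row_j (if (j < k)%N then w 0 j else 0).

Lemma row_prefix0 n (w : E R n) : row_prefix w 0 = 0.
Proof. by apply/matrixP => i j; rewrite !mxE. Qed.

Lemma row_prefix_full n (w : E R n) : row_prefix w n = w.
Proof. by apply/matrixP => i j; rewrite !mxE ltn_ord (ord1 i). Qed.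

Lemma row_prefixS n (w : E R n) (i : 'I_n) :
  row_prefix w i.+1 = row_prefix w i + w 0 i *: unitv i.
Proof.
apply/matrixP => a b; rewrite !mxE (ord1 a) eqxx /= ltnS leq_eqVlt.
have [->|bi] := eqVneq b i; first by rewrite eqxx ltnn add0r mulr1.
by rewrite (negbTE (bi : nat_of_ord b != i)) /= mulr0 addr0.
Qed.

Lemma norm_row_prefix_step n (w : E R n) (i : 'I_n) (t : R) :
  `|t| <= `|w| -> `|row_prefix w i + t *: unitv i| <= `|w|.
Proof.
move=> tw; apply: mx_norm_le => // a b; rewrite !mxE.
have [->|bi] := eqVneq b i; first by rewrite ltnn add0r (ord1 a) eqxx mulr1.
rewrite andbF mulr0 addr0; case: ifP => _; last by rewrite normr0.
exact: mx_norm_entry.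
Qed.

(* Walk from [y] to [y + w] along the coordinate axes, one coordinate at a time,
   and apply the mean value theorem on each of the [n] segments. *)
Lemma partials_increment_le n (h : E R n -> R) (y w : E R n) (c : 'I_n -> R)
    (d eps : R) :
  (forall z i, `|z - y| < d ->
     derivable h z (unitv i) /\ `|'D_(unitv i) h z - c i| <= eps) ->
  `|w| < d -> `|h (y + w) - h y - coord_form c w| <= n%:R * (`|w| * eps).
Proof.
move=> Hd wd; pose s := row_prefix w.
have step (i : 'I_n) :
    `|h (y + s i.+1) - h (y + s i) - w 0 i * c i| <= `|w| * eps.
  have eps0 : 0 <= eps.
    by apply: le_trans (Hd y i _).2; rewrite ?subrr ?normr0 // (le_lt_trans _ wd).
  rewrite /s row_prefixS addrA.
  apply: le_trans (@mean_value_line_le _ h (y + s i) (unitv i) (w 0 i) (c i) eps _) _.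
    move=> t ht; rewrite -addrA; apply: Hd.
    rewrite [y + _]addrC addrK; apply: le_lt_trans wd.
    exact/norm_row_prefix_step/(le_trans ht)/mx_norm_entry.
  by rewrite ler_wpM2r ?mx_norm_entry.
have -> : h (y + w) - h y - coord_form c w =
    \sum_(i < n) (h (y + s i.+1) - h (y + s i) - w 0 i * c i).
  rewrite sumrB /coord_form.
  rewrite -(big_mkord xpredT (fun k => h (y + s k.+1) - h (y + s k))).
  by rewrite telescope_sumr // /s row_prefix_full row_prefix0 addr0.
apply: le_trans (ler_norm_sum _ _ _) _.
by apply: le_trans (ler_sum _ (fun i _ => step i)) _; rewrite sumr_const card_ord mulr_natl.
Qed.

Lemma differentiable_of_continuous_partials {n} {U : set (E R n)} {h : E R n -> R} y :
  open U -> U y -> (forall z v, U z -> derivable h z v) ->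
  (forall i, {for y, continuous (fun z => 'D_(unitv i) h z)}) -> differentiable h y.
Proof.
move=> oU Uy hd hc; pose c i := 'D_(unitv i) h y.
apply: (@differentiable_of_littleo _ _ h (coord_form c) y).
  exact: coord_form_continuous.
apply/eqaddoP => e e0; pose eps := e / n.+1%:R.
have eps0 : 0 < eps by apply: divr_gt0.
have near_c : \forall z \near y, forall i, `|'D_(unitv i) h z - c i| <= eps.
  apply: (@filter_forall _ _ _ (nbhs y) (nbhs_filter y)) => i.
  exact: ((@cvgrPdistC_le _ _ _ _ (nbhs_filter y) _ _).1 (hc i) eps eps0).
have near_U := near_in_open oU Uy.
have [d d0 Hd] := (nbhs_ballP _ _).1 (filterI near_c near_U).
apply/nbhs_ballP; exists d => // w; rewrite -ball_normE /ball_ /= sub0r normrN => wd.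
change (`|h (w + y) - (h y + coord_form c w)| <= e * `|w|).
rewrite [w + y]addrC opprD addrA.
apply: le_trans (@partials_increment_le n h y w c d eps _ wd) _.
  move=> z i zy; have [] := Hd z; first by rewrite -ball_normE /ball_ /= distrC.
  by move=> Hc Uz; split; [exact: hd | exact: Hc].
rewrite mulrCA [e * _]mulrC ler_wpM2l // /eps mulrA ler_pdivrMr //.
by rewrite [_ * e]mulrC ler_wpM2l ?(ltW e0) // ler_nat.
Qed.

End PartialDerivatives.

Section FiniteOrderSmoothness.
Context {R : realType}.

Fixpoint Ck_on (k : nat) {n} (U : set (E R n)) (h : E R n -> R) : Prop :=
  match k with
  | 0 => forall y, U y -> {for y, continuous h}
  | k'.+1 => [/\ forall y, U y -> {for y, continuous h},
              forall y v, U y -> derivable h y v &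
              forall v, Ck_on k' U (fun z => 'D_v h z)]
  end.

Lemma Ck_on_continuous {k n} {U : set (E R n)} {h} :
  Ck_on k U h -> forall y, U y -> {for y, continuous h}.
Proof. by case: k => [|k] //= []. Qed.

Lemma Ck_on_pred {k n} {U : set (E R n)} {h} : Ck_on k.+1 U h -> Ck_on k U h.
Proof. by elim: k h => [|k IH] h /= [hc hd hD] //; split => // v; apply: IH. Qed.

Lemma Ck_on_eq {k n} {U : set (E R n)} {h g} : open U ->
  (forall z, U z -> h z = g z) -> Ck_on k U h -> Ck_on k U g.
Proof.
move=> oU; elim: k h g => [|k IH] h g hg.
  move=> hc y Uy; apply: near_eq_continuous (hc y Uy).
  exact: (filterS hg (near_in_open oU Uy)).
have near_hg y : U y -> \forall z \near y, h z = g z.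
  by move=> Uy; exact: (filterS hg (near_in_open oU Uy)).
case=> hc hd hD; split.
- by move=> y Uy; apply: near_eq_continuous (hc y Uy); apply: near_hg.
- by move=> y v Uy; apply: near_eq_derivable (hd y v Uy); apply: near_hg.
- move=> v; apply: (IH _ _ _ (hD v)) => z Uz.
  by apply: near_eq_derive; apply: near_hg.
Qed.

Lemma Ck_on_cst {k n} {U : set (E R n)} (a : R) : open U -> Ck_on k U (fun _ => a).
Proof.
move=> oU; elim: k a => [|k IH] a; first by move=> y _; exact: cst_continuous.
split.
- by move=> y _; exact: cst_continuous.
- by move=> y v _; exact: derivable_cst.
- by move=> v; apply: (Ck_on_eq oU _ (IH 0)) => z _; rewrite derive_cst.
Qed.

Lemma Ck_on_add {k n} {U : set (E R n)} {h g} : open U ->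
  Ck_on k U h -> Ck_on k U g -> Ck_on k U (fun z => h z + g z).
Proof.
move=> oU; elim: k h g => [|k IH] h g.
  by move=> hc gc y Uy; exact: (cvgD (hc y Uy) (gc y Uy)).
case=> hc hd hD [gc gd gD]; split.
- by move=> y Uy; exact: (cvgD (hc y Uy) (gc y Uy)).
- by move=> y v Uy; exact: (derivableD (hd y v Uy) (gd y v Uy)).
- move=> v; apply: (Ck_on_eq oU _ (IH _ _ (hD v) (gD v))) => z Uz.
  by rewrite -(deriveD (hd z v Uz) (gd z v Uz)).
Qed.

Lemma Ck_on_sum {k n} {U : set (E R n)} {m} (F : 'I_m -> E R n -> R) : open U ->
  (forall i, Ck_on k U (F i)) -> Ck_on k U (fun z => \sum_i F i z).
Proof.
move=> oU; elim: m F => [|m IH] F HF.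
  by apply: (Ck_on_eq oU _ (Ck_on_cst 0 oU)) => z _; rewrite big_ord0.
have := Ck_on_add oU (IH (fun i => F (widen_ord (leqnSn m) i)) (fun i => HF _))
  (HF ord_max).
by apply: Ck_on_eq => // z _; rewrite big_ord_recr.
Qed.

Lemma Ck_on_mul {k n} {U : set (E R n)} {h g} : open U ->
  Ck_on k U h -> Ck_on k U g -> Ck_on k U (fun z => h z * g z).
Proof.
move=> oU; elim: k h g => [|k IH] h g.
  by move=> hc gc y Uy; exact: (cvgM (hc y Uy) (gc y Uy)).
move=> Hh Hg; move: (Hh) (Hg) => [hc hd hD] [gc gd gD]; split.
- by move=> y Uy; exact: (cvgM (hc y Uy) (gc y Uy)).
- by move=> y v Uy; exact: (derivableM (hd y v Uy) (gd y v Uy)).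
- move=> v.
  have := Ck_on_add oU (IH _ _ (Ck_on_pred Hh) (gD v)) (IH _ _ (Ck_on_pred Hg) (hD v)).
  by apply: Ck_on_eq => // z Uz; rewrite (deriveM (hd z v Uz) (gd z v Uz)).
Qed.

Lemma Ck_on_differentiable {k n} {U : set (E R n)} {h} y :
  open U -> U y -> Ck_on k.+1 U h -> differentiable h y.
Proof.
move=> oU Uy [hc hd hD]; apply: (differentiable_of_continuous_partials y oU Uy) => // i.
exact: (Ck_on_continuous (hD (unitv i)) y Uy).
Qed.

Lemma continuous_of_coords {n l} (F : E R n -> E R l) y :
  (forall i, {for y, continuous (fun z => F z 0 i)}) -> {for y, continuous F}.
Proof.
move=> H; apply/(@cvgrPdist_le _ _ _ (nbhs y) (nbhs_filter y)) => e e0.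
have : \forall t \near y, forall i, `|F y 0 i - F t 0 i| <= e.
  apply: (@filter_forall _ _ _ (nbhs y) (nbhs_filter y)) => i.
  exact: ((@cvgrPdist_le _ _ _ _ (nbhs_filter y) _ _).1 (H i) e e0).
apply: filterS => t Ht; apply: mx_norm_le (ltW e0) _ => a b.
by rewrite (ord1 a) !mxE; exact: Ht.
Qed.

Lemma differentiable_of_coords {n l} (F : E R n -> E R l) y :
  (forall i, differentiable (fun z => F z 0 i) y) -> differentiable F y.
Proof.
move=> H; have -> : F = \sum_i (fun z => F z 0 i *: (unitv i : E R l)).
  by rewrite fct_sumE; apply/funext => z; exact: row_sum_delta.
by apply: differentiable_sum => i; exact: differentiableZl.
Qed.

Lemma derive_comp_coords {n l} (F : E R n -> E R l) (g : E R l -> R) z v :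
  differentiable F z -> differentiable g (F z) ->
  'D_v (fun t => g (F t)) z =
    \sum_i 'D_v (fun t => F t 0 i) z * 'D_(unitv i) g (F z).
Proof.
move=> dF dg; have dgF : differentiable (g \o F) z by exact: differentiable_comp.
rewrite (deriveE v dgF) diff_comp //= -(deriveE v dF).
rewrite (derive_mx (diff_derivable dF)); set u := (\matrix_(i, j) _).
rewrite {1}(row_sum_delta u) linear_sum; apply: eq_bigr => i _.
by rewrite linearZ /= -(deriveE _ dg) /u mxE.
Qed.

Lemma Ck_on_comp k {n l} {U : set (E R n)} {V : set (E R l)} {F : E R n -> E R l}
    {g : E R l -> R} :
  open U -> open V -> (forall z, U z -> V (F z)) ->
  (forall i, Ck_on k U (fun z => F z 0 i)) -> Ck_on k V g ->
  Ck_on k U (fun z => g (F z)).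
Proof.
move=> oU oV; elim: k F g => [|k IH] F g FUV HF Hg.
  move=> y Uy; apply: (@continuous_comp _ _ _ F g); last exact: Hg (FUV y Uy).
  by apply: continuous_of_coords => i; exact: HF.
have dF z : U z -> differentiable F z.
  by move=> Uz; apply: differentiable_of_coords => i;
    exact: (Ck_on_differentiable z oU Uz (HF i)).
have dg w : V w -> differentiable g w.
  by move=> Vw; exact: (Ck_on_differentiable w oV Vw Hg).
move: (Hg) => [gc gd gD]; split.
- move=> y Uy; apply: (@continuous_comp _ _ _ F g); last exact: gc (FUV y Uy).
  by apply: continuous_of_coords => i; case: (HF i) => + _ _; apply.
- by move=> y v Uy; apply/diff_derivable/differentiable_comp; [exact: dF|exact: dg (FUV y Uy)].
- move=> v.
  have := Ck_on_sum _ oU (fun i => Ck_on_mul oU (let: And3 _ _ D := HF i in D v)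
             (IH F _ FUV (fun j => Ck_on_pred (HF j)) (gD (unitv i)))).
  apply: Ck_on_eq => // z Uz.
  by rewrite (derive_comp_coords F g z v (dF z Uz) (dg _ (FUV z Uz))).
Qed.

End FiniteOrderSmoothness.

Section Smoothness.
Context {R : realType}.

Fixpoint iter_deriveR {n} (vs : seq (E R n)) (h : E R n -> R) : E R n -> R :=
  if vs is v :: vs' then fun y => 'D_v (iter_deriveR vs' h) y else h.

Definition smoothR_on {n} (U : set (E R n)) (h : E R n -> R) : Prop :=
  forall vs y, U y ->
    {for y, continuous (iter_deriveR vs h)} /\ forall v, derivable (iter_deriveR vs h) y v.

Lemma iter_deriveR_rcons n (vs : seq (E R n)) v h :
  iter_deriveR (rcons vs v) h = iter_deriveR vs (fun y => 'D_v h y).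
Proof. by elim: vs => [|w vs IH] //=; rewrite IH. Qed.

Lemma smoothR_onP {n} {U : set (E R n)} {h} : smoothR_on U h <-> forall k, Ck_on k U h.
Proof.
split=> [H k|H vs].
  elim: k h H => [|k IH] h H; first by move=> y Uy; exact: (H [::] y Uy).1.
  split.
  - by move=> y Uy; exact: (H [::] y Uy).1.
  - by move=> y v Uy; exact: (H [::] y Uy).2.
  - by move=> v; apply: IH => vs y Uy; rewrite -iter_deriveR_rcons; exact: H.
elim/last_ind: vs h H => [|vs v IH] h H y Uy.
  split; first exact: (H 0%N y Uy).
  by move=> v; case: (H 1%N) => _ /(_ y v Uy).
rewrite iter_deriveR_rcons; apply: IH => // k.
by case: (H k.+1) => _ _ /(_ v).
Qed.

Lemma iter_deriv_coord {n m} {U : set (E R n)} {F : E R n -> E R m} : open U ->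
  (forall vs y v, U y -> derivable (iter_deriv R n m vs F) y v) ->
  forall vs y j, U y ->
    iter_deriv R n m vs F y 0 j = iter_deriveR vs (fun z => F z 0 j) y.
Proof.
move=> oU H; elim=> [|v vs IH] y j Uy //=.
rewrite (derive_mx (H vs y v Uy)) mxE; apply: near_eq_derive.
by apply: (filterS _ (near_in_open oU Uy)) => t Ut; exact: IH.
Qed.

Lemma smooth_on_smoothR_coord {n m} {U : set (E R n)} {F : E R n -> E R m} j :
  open U -> smooth_on R n m U F -> smoothR_on U (fun z => F z 0 j).
Proof.
move=> oU sF vs y Uy.
have Hd vs' z v : U z -> derivable (iter_deriv R n m vs' F) z v.
  by move=> Uz; exact: ((sF vs').2 z v Uz).
have Hn : \forall t \near y,
    iter_deriv R n m vs F t 0 j = iter_deriveR vs (fun z => F z 0 j) t.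
  by apply: (filterS _ (near_in_open oU Uy)) => t Ut; exact: (iter_deriv_coord oU Hd).
split.
- apply: (near_eq_continuous Hn).
  apply: (@continuous_comp _ _ _ (iter_deriv R n m vs F) (fun M : E R m => M 0 j)).
    exact: ((sF vs).1 y Uy).
  exact: coord_continuous.
- move=> v; apply: (near_eq_derivable Hn).
  by move/derivable_mxP: (Hd vs y v Uy); apply.
Qed.

Lemma smoothR_coord_smooth_on {n m} {U : set (E R n)} {F : E R n -> E R m} :
  open U -> (forall j, smoothR_on U (fun z => F z 0 j)) -> smooth_on R n m U F.
Proof.
move=> oU H.
have P vs y : U y ->
    (forall j, iter_deriv R n m vs F y 0 j = iter_deriveR vs (fun z => F z 0 j) y)
    /\ forall v, derivable (iter_deriv R n m vs F) y v.
  elim: vs y => [|v vs IH] y Uy.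
    split => // w; apply/derivable_mxP => i j; rewrite (ord1 i).
    exact: ((H j [::] y Uy).2 w).
  have Eq z j : U z ->
      iter_deriv R n m (v :: vs) F z 0 j = iter_deriveR (v :: vs) (fun z => F z 0 j) z.
    move=> Uz /=; rewrite (derive_mx ((IH z Uz).2 v)) mxE.
    apply: near_eq_derive.
    by apply: (filterS _ (near_in_open oU Uz)) => t Ut; exact: ((IH t Ut).1 j).
  split=> [j|w]; first exact: Eq.
  apply/derivable_mxP => i j; rewrite (ord1 i).
  apply: (near_eq_derivable _ ((H j (v :: vs) y Uy).2 w)).
  by apply: (filterS _ (near_in_open oU Uy)) => t Ut; rewrite Eq.
move=> vs; split=> [y Uy|y v Uy]; last exact: (P vs y Uy).2.
apply: continuous_of_coords => j.
have Hn : \forall t \near y,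
    iter_deriveR vs (fun z => F z 0 j) t = iter_deriv R n m vs F t 0 j.
  by apply: (filterS _ (near_in_open oU Uy)) => t Ut; rewrite (P vs t Ut).1.
exact: (near_eq_continuous Hn (H j vs y Uy).1).
Qed.

Lemma smooth_on_differentiable {n m} {U : set (E R n)} {F : E R n -> E R m} y :
  open U -> smooth_on R n m U F -> U y -> differentiable F y.
Proof.
move=> oU sF Uy; apply: differentiable_of_coords => j.
have /smoothR_onP/(_ 1%N) := smooth_on_smoothR_coord j oU sF.
exact: Ck_on_differentiable.
Qed.

Lemma smooth_on_comp {n l m} {U : set (E R n)} {V : set (E R l)}
    {F : E R n -> E R l} {G : E R l -> E R m} : open U -> open V ->
  smooth_on R n l U F -> smooth_on R l m V G -> (forall z, U z -> V (F z)) ->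
  smooth_on R n m U (G \o F).
Proof.
move=> oU oV sF sG FUV; apply: smoothR_coord_smooth_on => // j.
apply/smoothR_onP => k.
apply: (Ck_on_comp k (g := fun w => G w 0 j) oU oV FUV).
  by move=> i; exact: (smoothR_onP.1 (smooth_on_smoothR_coord i oU sF)).
exact: (smoothR_onP.1 (smooth_on_smoothR_coord j oV sG)).
Qed.

Lemma smooth_on_sub {n m} {U W : set (E R n)} {F : E R n -> E R m} :
  W `<=` U -> smooth_on R n m U F -> smooth_on R n m W F.
Proof. by move=> WU sF vs; split=> [y|y v] /WU; [exact: (sF vs).1|exact: (sF vs).2]. Qed.

End Smoothness.

Section LinearRange.
Variables (R : realType) (L T : lmodType R) (f : {linear L -> T}).

Definition lin_range : {pred T} := fun y => `[< exists z, f z = y >].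

Lemma lin_range_submod_closed : GRing.submod_closed lin_range.
Proof.
split; first by apply/asboolP; exists 0; rewrite linear0.
move=> a u v /asboolP [zu <-] /asboolP [zv <-].
by apply/asboolP; exists (a *: zu + zv); rewrite linearP.
Qed.

HB.instance Definition _ :=
  GRing.isSubmodClosed.Build _ _ lin_range lin_range_submod_closed.

Record lin_range_type := LinRange { lin_range_val : T; _ : lin_range_val \in lin_range }.

HB.instance Definition _ := [isSub for lin_range_val].
HB.instance Definition _ := [Choice of lin_range_type by <:].
HB.instance Definition _ := [SubChoice_isSubLmodule of lin_range_type by <:].

End LinearRange.
Arguments lin_range {R L T}.
Arguments lin_range_type {R L T}.

Section Colimits.
Context {R : realType} {X : Type}.

Lemma colimit_endo_id {Ob : gobj R X -> Prop} {Hom : homs R X} {L : lmodType R}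
    {iota : forall p : gobj R X, E R (gdim R X p) -> L} (psi : L -> L) :
  is_colimit R X Ob Hom L iota -> is_lin R L L psi ->
  (forall p, Ob p -> forall v, psi (iota p v) = iota p v) -> forall y, psi y = y.
Proof.
move=> [iota_cocone iota_univ] psi_lin psi_iota y.
have [phi [_ _ phi_uniq]] := iota_univ L iota iota_cocone.
apply: etrans (phi_uniq psi psi_lin psi_iota y) _.
by apply/esym/(phi_uniq id).
Qed.

Lemma colimit_lin_surjective {Ob : gobj R X -> Prop} {Hom : homs R X}
    {T : lmodType R} {iota : forall p : gobj R X, E R (gdim R X p) -> T} :
  is_colimit R X Ob Hom T iota ->
  (forall p q f, Hom p q f -> Ob p /\ Ob q) ->
  forall (L : lmodType R) (phi : L -> T), is_lin R L T phi ->
  (forall p, Ob p -> forall v, exists z, phi z = iota p v) ->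
  forall y, exists z, phi z = y.
Proof.
move=> Tcolim HomOb L phi phi_lin phi_hits y.
pose lphi : {linear L -> T} := HB.pack phi (GRing.isLinear.Build R L T _ phi phi_lin).
pose S := lin_range_type lphi.
have [[iota_lin iota_comm] iota_univ] := Tcolim.
have iota_in p v : Ob p -> iota p v \in lin_range lphi.
  by move=> Op; apply/asboolP; exact: phi_hits.
pose iotaS p v := insubd (0 : S) (iota p v).
have iotaSK p v : Ob p -> val (iotaS p v) = iota p v.
  by move=> Op; rewrite /iotaS insubdK // iota_in.
have iotaS_cocone : cocone R X Ob Hom S iotaS.
  split=> [p Op a u v|p q f Hf v]; apply: val_inj => /=.
    by rewrite !iotaSK // iota_lin.
  by have [Op Oq] := HomOb p q f Hf; rewrite !iotaSK // iota_comm.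
have [sigma [sigma_lin sigma_iota _]] := iota_univ S iotaS iotaS_cocone.
have val_sigma : forall t, val (sigma t) = t.
  apply: (colimit_endo_id (fun t => val (sigma t)) Tcolim) => [a u v|p Op v].
    by rewrite sigma_lin.
  by rewrite sigma_iota // iotaSK.
by have /asboolP := valP (sigma y); rewrite val_sigma.
Qed.

End Colimits.

Section GermCategory.
Context {R : realType} {X : Type} {D : diffeology R X} {x : X}.

Local Notation ghom := (ghom R X D x).

Lemma ghom_differentiable {p q f} : ghom p q f -> differentiable f 0.
Proof.
by case=> _ [_ [W [[oW W0 _ sm] _]]]; exact: (smooth_on_differentiable 0 oW sm W0).
Qed.

Lemma ghom0 {p q f} : ghom p q f -> f 0 = 0.
Proof. by case=> _ [_ [W [_ [_ f0 _]]]]. Qed.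

Lemma ghom_comp {p q r f g} : ghom p q f -> ghom q r g -> ghom p r (g \o f).
Proof.
move=> [gp [gq [W [[oW W0 Wp sm] [fW f0 pf]]]]].
move=> [_ [gr [W' [[oW' W'0 W'q sm'] [gW' g0 qg]]]]].
split => //; split => //; exists (W `&` f @^-1` W').
have fcont z : W z -> {for z, continuous f}.
  by move=> Wz; apply/differentiable_continuous/(smooth_on_differentiable z oW sm).
have oWW' : open (W `&` f @^-1` W').
  rewrite openE => z [Wz W'fz]; apply: filterI; first exact: near_in_open oW Wz.
  exact: fcont Wz _ (near_in_open oW' W'fz).
split; split => //.
- by split => //=; rewrite f0.
- by move=> z [Wz _]; exact: Wp.
- apply: (smooth_on_comp oWW' oW' (smooth_on_sub _ sm) sm') => [z []|z []] //.
- by move=> _ [z [Wz W'fz] <-]; apply: gW'; exists (f z).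
- by rewrite /= f0 g0.
- by move=> w [Ww W'fw]; rewrite /= pf // qg.
Qed.

Lemma ghom_diff_germ {p q r f g h} v :
  ghom p q f -> ghom q r g -> ghom p r h -> germ_eq R _ _ (g \o f) h ->
  'd h 0 v = 'd g (f 0) ('d f 0 v).
Proof.
move=> hf hg hh gfh; have df := ghom_differentiable hf.
have dg : differentiable g (f 0) by rewrite (ghom0 hf); exact: ghom_differentiable hg.
have dgf : differentiable (g \o f) 0 by exact: differentiable_comp.
rewrite -(deriveE v (ghom_differentiable hh)).
have -> : 'D_v h 0 = 'D_v (g \o f) 0.
  by apply: near_eq_derive; apply: filterS gfh => w ->.
by rewrite (deriveE v dgf) diff_comp.
Qed.

End GermCategory.

Section Comparison.
Context {R : realType} {X : Type} {D : diffeology R X} {x : X}.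
Context {Ob : gobj R X -> Prop} {Hom : homs R X}.
Context (HG : local_generating_category R X D x Ob Hom).
Context {LG : lmodType R} {iG : forall p : gobj R X, E R (gdim R X p) -> LG}.
Context (LGcolim : is_colimit R X Ob Hom LG iG).
Context {T : lmodType R} {iT : forall p : gobj R X, E R (gdim R X p) -> T}.
Context (Tcolim : is_colimit R X (is_gobj R X D x) (ghom R X D x) T iT).

Local Notation ghom := (ghom R X D x).
Local Notation is_gobj := (is_gobj R X D x).

Lemma cocone_restrict {L : lmodType R} {iota : forall p, E R (gdim R X p) -> L} :
  cocone R X is_gobj ghom L iota -> cocone R X Ob Hom L iota.
Proof.
have [[Obg HomOb _ _ _] _] := HG.
move=> [iota_lin iota_comm]; split=> [p /Obg|p q f /HomOb [_ _]]; [exact: iota_lin|].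
exact: iota_comm.
Qed.

Lemma comparison_surjective {phi : LG -> T} : is_lin R LG T phi ->
  (forall p, Ob p -> forall v, phi (iG p v) = iT p v) -> forall y, exists z, phi z = y.
Proof.
move=> phi_lin phi_iG.
apply: (colimit_lin_surjective Tcolim _ _ _ phi_lin); first by move=> p q f [gp [gq _]].
have [[_ _ _ _ _] Ob_gen] := HG; have [[_ iT_comm] _] := Tcolim.
move=> p gp v; have [q [f [Oq hf]]] := Ob_gen p gp.
by exists (iG q ('d f 0 v)); rewrite phi_iG // iT_comm.
Qed.

Definition comma_leg {p : gobj R X} (a : comma_obj R X p) (v : E R (gdim R X p)) : LG :=
  iG (projT1 a) ('d (projT2 a) 0 v).

Context (Gfinal : final_subcategory R X D x Ob Hom).

(* The value of the leg does not change along a morphism of the comma category p / G,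
   so by connectedness it does not depend on the object of p / G. *)
Lemma comma_leg_const {p a b} : is_gobj p ->
  comma_valid R X D x Ob p a -> comma_valid R X D x Ob p b -> comma_leg a =1 comma_leg b.
Proof.
have [[_ HomOb _ _ _] _] := HG; have [[_ iG_comm] _] := LGcolim.
move=> gp Va Vb; elim: ((Gfinal p gp).2 a b Va Vb) => {a b Va Vb}
  [a b [Va Vb [h [Hh germ]]]|a|a b _ IH|a b c _ IH1 _ IH2] v.
- case: a b Va Vb h Hh germ => qa fa [qb fb] /= [_ ha] [_ hb] h Hh germ.
  have [_ _ hh] := HomOb qa qb h Hh; simpl in ha, hb.
  rewrite /comma_leg /= (ghom_diff_germ v ha hh hb germ) (ghom0 ha).
  by rewrite (iG_comm _ _ _ Hh).
- by [].
- by rewrite IH.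
- by rewrite IH1 IH2.
Qed.

Lemma final_cocone : exists iota : forall p, E R (gdim R X p) -> LG,
  cocone R X is_gobj ghom LG iota /\ forall p, Ob p -> iota p =1 iG p.
Proof.
have [[Obg HomOb _ Homid _] _] := HG; have [[iG_lin _] _] := LGcolim.
have ch p : {a : comma_obj R X p | is_gobj p -> comma_valid R X D x Ob p a}.
  apply: cid; have [gp|ngp] := pselect (is_gobj p).
    by have [a Va] := (Gfinal p gp).1; exists a.
  by exists (existT _ p id).
exists (fun p => comma_leg (sval (ch p))); split; last first.
  move=> p Op v; have [_ _ hid] := HomOb p p id (Homid p Op).
  have Vid : comma_valid R X D x Ob p (existT _ p id) by [].
  rewrite (comma_leg_const (Obg p Op) (svalP (ch p) (Obg p Op)) Vid v).
  by rewrite /comma_leg diff_val.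
split=> [p gp a u w|p q f hf v].
  have [Oa _] := svalP (ch p) gp.
  by rewrite /comma_leg linearP iG_lin.
have [gp [gq _]] := hf; have [Oq hg] := svalP (ch q) gq.
have Vb : comma_valid R X D x Ob p
    (existT _ (projT1 (sval (ch q))) (projT2 (sval (ch q)) \o f)).
  by split=> //; exact: ghom_comp hf hg.
rewrite (comma_leg_const gp (svalP (ch p) gp) Vb v) /comma_leg /=.
rewrite (ghom_diff_germ v hf hg (ghom_comp hf hg)) ?(ghom0 hf) //.
exact: filterE.
Qed.

End Comparison.

Theorem proposition3p2 (R : realType) (X : Type) (D : diffeology R X) (x : X)
    (Ob : gobj R X -> Prop) (Hom : homs R X)
    (HG : local_generating_category R X D x Ob Hom)
    (LG : lmodType R) (iG : forall p : gobj R X, E R (gdim R X p) -> LG)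
    (HLG : is_colimit R X Ob Hom LG iG)
    (T : lmodType R) (iT : forall p : gobj R X, E R (gdim R X p) -> T)
    (HT : is_colimit R X (is_gobj R X D x) (ghom R X D x) T iT) :
  exists phi : LG -> T,
    [/\ is_lin R LG T phi,
        (forall p, Ob p -> forall v, phi (iG p v) = iT p v),
        (forall y : T, exists z : LG, phi z = y) &
        (final_subcategory R X D x Ob Hom -> injective phi)].
Proof.
have [[Obg _ _ _ _] _] := HG.
have [phi [phi_lin phi_iG _]] := HLG.2 T iT (cocone_restrict HG HT.1).
exists phi; split=> //.
  exact: (comparison_surjective HG HT (phi := phi) phi_lin phi_iG).
move=> Gfinal; have [iota [iota_cocone iota_iG]] := final_cocone HG HLG Gfinal.
have [psi [psi_lin psi_iT _]] := HT.2 LG iota iota_cocone.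
have psi_phi : cancel phi psi.
  apply: (colimit_endo_id (psi \o phi) HLG) => [a u v|p Op v] /=.
    by rewrite phi_lin psi_lin.
  by rewrite phi_iG // psi_iT ?iota_iG //; exact: Obg.
exact: can_inj psi_phi.
Qed.
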